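(* Let $d\ge2$, $L\ge2$, let $q=(q_0,\ldots,q_{d-1})$ be a probability distribution, and let $P_k^{(\alpha)}=|e_k^{(\alpha)}\rangle\langle e_k^{(\alpha)}|$ ($k=0,\ldots,d-1$, $\alpha=1,\ldots,L$) be the projectors onto the vectors of a set of $L$ mutually equibiased bases (MEBs) of a $d$-dimensional Hilbert space associated with $q$, satisfying $\lambda_{\max}(N)<1/(L-1)$. For $\alpha=1,\ldots,L$ let $\mathcal{O}^{(\alpha)}$ be an orthogonal rotation in $\mathbb{R}^d$ around the axis $\boldsymbol{n}_*=(1,1,\ldots,1)/\sqrt d$, so that $\mathcal{O}^{(\alpha)}\boldsymbol{n}_*=\boldsymbol{n}_*$. Let $$\gamma=\bigg[\frac{d-1}{(d-1)f_L(q)+L(L-1)(d\,q_{\max}-1)}\bigg]^{1/2},$$ where $q_{\max}=\max\{q_0,\ldots,q_{d-1}\}$ and $f_L(q)=1+(L-1)\lambda_{\max}(N)$. Then the linear map $$\Phi X=\left[\frac{d+\gamma L-1}{d(d-1)}\right]\mathrm{Tr}[X]\,\mathbb{I}_d-\frac{\gamma}{d-1}\sum_{\alpha=1}^{L}\sum_{k,l=0}^{d-1}\mathcal{O}_{k,l}^{(\alpha)}\,\mathrm{Tr}[XP_l^{(\alpha)}]\,P_k^{(\alpha)}$$ is positive (i.e. $\Phi X\ge0$ for all $X\ge0$) and trace preserving.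
   Context: Mutually equibiased bases: let $\mathcal{H}$ be a $d$-dimensional complex Hilbert space and $q=(q_0,\ldots,q_{d-1})$ a probability distribution. A set of $L$ orthonormal bases $\mathcal{B}^{(\alpha)}=\{|e_k^{(\alpha)}\rangle\}_{k=0}^{d-1}$, $\alpha=1,\ldots,L$, of $\mathcal{H}$ is called a set of mutually equibiased bases (MEBs) associated with $q$ if for every pair $\alpha\neq\beta$ there is a permutation $\sigma$ of $\{0,1,\ldots,d-1\}$ (which may depend on the pair $(\alpha,\beta)$) such that $$\mathrm{Tr}\big[P_k^{(\alpha)}P_l^{(\beta)}\big]=q_{\sigma(k)\oplus\sigma(l)}\qquad\text{for all }k,l\in\{0,\ldots,d-1\},$$ where $P_k^{(\alpha)}=|e_k^{(\alpha)}\rangle\langle e_k^{(\alpha)}|$ and $\oplus$ denotes addition modulo $d$. By convention $\mathcal{B}^{(1)}$ is the standard (computational) basis, and $\sigma$ is taken to be the identity when one of the two bases is the standard basis. The matrix $N$: $N$ is the $(d-1)\times(d-1)$ Hermitian matrix (indices $1,\ldots,d-1$) whose only nonzero entries are on the antidiagonal, $N_{k,d-k}=\sum_{m=0}^{d-1}\omega^{-km}q_m$ for $k=1,\ldots,d-1$, with $\omega=e^{2\pi i/d}$. Define $\lambda_{\max}(N)=\max_k|N_{k,d-k}|$, the maximum taken over $k\in\{1,\ldots,(d-1)/2\}$ if $d$ is odd and over $k\in\{1,\ldots,d/2\}$ if $d$ is even. $\mathbb{I}_d$ is the identity operator; $\mathcal{O}^{(\alpha)}_{k,l}$ are the entries (indices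 $0,\ldots,d-1$) of the orthogonal matrix $\mathcal{O}^{(\alpha)}$. *)

(* Defs.v *)
(* The d-dimensional Hilbert space is 'cV[R[i]]_d; on R[i], 0 <= z means that z
   is real and nonnegative. *)
From HB Require Import structures.
From mathcomp Require Import all_boot all_order all_algebra all_fingroup.
From mathcomp Require Import all_classical all_reals all_analysis.
From mathcomp Require Import complex.

Set Implicit Arguments.
Unset Strict Implicit.
Unset Printing Implicit Defensive.

Import Order.TTheory GRing.Theory Num.Theory.

Local Open Scope ring_scope.
Local Open Scope sesquilinear_scope.
Local Open Scope complex_scope.

Definition is_distr (R : realType) d (q : 'I_d -> R) : Prop :=
  (forall k, 0 <= q k) /\ \sum_k q k = 1.

Definition add_mod d (k l : 'I_d) : 'I_d :=
  Ordinal (ltn_pmod (k + l) (leq_ltn_trans (leq0n k) (ltn_ord k))).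

Definition projector (R : realType) d (v : 'cV[R[i]]_d) : 'M[R[i]]_d := v *m v ^t*.

(* d orthonormal vectors of a d-dimensional space are automatically a basis. *)
Definition orthonormal_basis (R : realType) d (e : 'I_d -> 'cV[R[i]]_d) : Prop :=
  forall k l, ((e k) ^t* *m e l) 0 0 = (k == l)%:R.

(* Bases are numbered from 0, and the convention singling out one of them is
   part of the definition: basis number 0 is the computational basis, and the
   permutation of a pair containing it is the identity. *)
Definition mutually_equibiased (R : realType) d L (q : 'I_d -> R)
    (e : 'I_L -> 'I_d -> 'cV[R[i]]_d) : Prop :=
  [/\ forall a, orthonormal_basis (e a),
      forall a : 'I_L, a = 0%N :> nat -> forall k, e a k = delta_mx k 0
    & forall a b : 'I_L, a != b ->
      exists s : {perm 'I_d},
        (a = 0%N :> nat \/ b = 0%N :> nat -> s = 1%g) /\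
        forall k l, \tr (projector (e a k) *m projector (e b l))
                    = (q (add_mod (s k) (s l)))%:C].

Definition omega (R : realType) (d : nat) : R[i] :=
  cos (2 * pi / d%:R) +i* sin (2 * pi / d%:R).

(* Rows and columns 1, ..., d-1 are numbered 0, ..., d-2: the ordinal i stands
   for the index i.+1, and rev_ord i for the index d - i.+1. *)
Definition Nmx (R : realType) d (q : 'I_d -> R) : 'M[R[i]]_d.-1 :=
  \matrix_(i, j)
    if (i.+1 + j.+1 == d)%N
    then \sum_(m < d) omega R d ^- (i.+1 * m) * (q m)%:C else 0.

Definition lambda_max (R : realType) d (N : 'M[R[i]]_d.-1) : R :=
  \big[Num.max/0]_(i < d.-1 | (i.+1 <= if odd d then d.-1./2 else d./2)%N)
    Normc.normc (N i (rev_ord i)).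

Definition qmax (R : realType) d (q : 'I_d -> R) : R := \big[Num.max/0]_k q k.

Definition fL (R : realType) d (L : nat) (q : 'I_d -> R) : R :=
  1 + (L%:R - 1) * lambda_max (Nmx q).

Definition gamma (R : realType) d (L : nat) (q : 'I_d -> R) : R :=
  Num.sqrt ((d%:R - 1) /
    ((d%:R - 1) * fL L q + L%:R * (L%:R - 1) * (d%:R * qmax q - 1))).

Definition nstar (R : realType) d : 'cV[R]_d := const_mx (Num.sqrt d%:R)^-1.

(* No condition on the determinant: any orthogonal matrix fixing the axis. *)
Definition rotation_about_nstar (R : realType) d (O : 'M[R]_d) : Prop :=
  O^T *m O = 1%:M /\ O *m nstar R d = nstar R d.

Definition Phi (R : realType) d L (g : R) (O : 'I_L -> 'M[R]_d)
    (e : 'I_L -> 'I_d -> 'cV[R[i]]_d) (X : 'M[R[i]]_d) : 'M[R[i]]_d :=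
  (((d%:R + g * L%:R - 1) / (d%:R * (d%:R - 1)))%:C * \tr X) *: 1%:M
  - (g / (d%:R - 1))%:C *:
    \sum_(a < L) \sum_(k < d) \sum_(l < d)
      ((O a k l)%:C * \tr (X *m projector (e a l))) *: projector (e a k).

Lemma Phi_is_linear (R : realType) d L (g : R) (O : 'I_L -> 'M[R]_d)
    (e : 'I_L -> 'I_d -> 'cV[R[i]]_d) : linear (Phi g O e).
Proof.
move=> c X Y; rewrite /Phi scalerBr addrACA -opprD; congr (_ - _).
  by rewrite mxtraceD mxtraceZ scalerA -scalerDl mulrDr mulrCA.
rewrite scalerA [c * _]mulrC -scalerA -scalerDr; congr (_ *: _).
rewrite scaler_sumr -big_split; apply: eq_bigr => a _ /=.
rewrite scaler_sumr -big_split; apply: eq_bigr => k _ /=.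
rewrite scaler_sumr -big_split; apply: eq_bigr => l _ /=.
rewrite scalerA -scalerDl mulmxDl -scalemxAl mxtraceD mxtraceZ.
by rewrite mulrDr mulrCA.
Qed.

HB.instance Definition _ (R : realType) d L (g : R) (O : 'I_L -> 'M[R]_d)
    (e : 'I_L -> 'I_d -> 'cV[R[i]]_d) :=
  GRing.isLinear.Build R[i] 'M[R[i]]_d 'M[R[i]]_d *:%R (Phi g O e)
    (Phi_is_linear g O e).

(* Over the complex numbers this already forces X to be Hermitian. *)
Definition psd (R : realType) d (X : 'M[R[i]]_d) : Prop :=
  forall v : 'cV[R[i]]_d, 0 <= (v ^t* *m X *m v) 0 0.

Definition positive_map (R : realType) d
    (F : {linear 'M[R[i]]_d -> 'M[R[i]]_d}) : Prop :=
  forall X, psd X -> psd (F X).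

Definition trace_preserving (R : realType) d
    (F : {linear 'M[R[i]]_d -> 'M[R[i]]_d}) : Prop :=
  forall X, \tr (F X) = \tr X.

(* Main.v *)
(** For positive X write t = Tr X, tau^a_k = Tr[X P_k^a] - t/d, S = sum |tau^a_k|^2
    and D = sum tau^a_k P_k^a. Since Tr X^2 <= t^2, the inequality
    0 <= Tr[(X - t/d - x D)^2], valid for all real x, becomes
    0 <= (1 - 1/d) t^2 - 2 x S + x^2 Tr D^2.
    The form Tr D^2 is at most f_L S, because its off-diagonal blocks are
    convolutions with q, diagonalized by the discrete Fourier transform; bounding
    the overlaps by q_max instead, it is at most S + L(L-1)(q_max - 1/d) t^2.
    Taking x = 1/f_L bounds S by f_L (1 - 1/d) t^2, and then x = gamma gives
    gamma S <= (1 - 1/d) t^2. Finally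
    <v|Phi X|v> = t |v|^2/d - gamma/(d-1) sum_a <O^a tau^a(X), tau^a(|v><v|)>,
    and Cauchy-Schwarz with the last bound, applied to X and to |v><v|, makes
    this nonnegative. *)
Require Import Defs.
From mathcomp Require Import all_boot all_order all_algebra all_fingroup.
From mathcomp Require Import all_classical all_reals all_analysis.
From mathcomp Require Import complex zify ring lra.

Import Order.TTheory GRing.Theory Num.Theory.
Local Open Scope ring_scope.
Local Open Scope complex_scope.

(** * Positive semidefinite complex matrices *)

Section Psd.
Local Open Scope ring_scope.
Local Open Scope sesquilinear_scope.
Context (R : realType) (d : nat).
Implicit Types (X Y : 'M[R[i]]_d) (v : 'cV[R[i]]_d).

(** Positivity tested on the vector [x e_i + y e_j]; choices of [x] and [y] give every entrywise
    fact about positive matrices below. *)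
Lemma psd_form X i j (x y : R[i]) : psd X ->
  0 <= x^* * x * X i i + x^* * y * X i j + y^* * x * X j i + y^* * y * X j j.
Proof.
move=> /(_ (x *: delta_mx i 0 + y *: delta_mx j 0)).
rewrite [_^T]linearD /= ![(_ *: _)^T]linearZ /= !trmx_delta map_mxD !map_mxZ !map_delta_mx.
rewrite !mulmxDr !mulmxDl -!scalemxAl -!scalemxAr -!rowE -!colE !mxE /=.
by congr (0 <= _); ring.
Qed.

Lemma psd_diag_ge0 X i : psd X -> 0 <= X i i.
Proof.
move=> /(psd_form X i i 1 0).
by rewrite rmorph1 rmorph0 !(mul0r, mulr0, addr0, mul1r).
Qed.

(** Polarization: the diagonal is real, so the test vectors [e_i + e_j] and [e_i + 'i e_j] show that
    [X_ij + X_ji] and ['i (X_ij - X_ji)] are real. *)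
Lemma psd_hermitian X i j : psd X -> X j i = (X i j)^*.
Proof.
move=> Xpsd.
have diagJ k : (X k k)^* = X k k by apply/conj_Creal/ger0_real/psd_diag_ge0.
have /conj_Creal := ger0_real (psd_form X i j 1 1 Xpsd).
rewrite !rmorphD !rmorphM !rmorph1 /= !diagJ !mul1r => /addIr.
rewrite -!addrA => /addrI eRe.
have /conj_Creal := ger0_real (psd_form X i j 1 'i Xpsd).
rewrite !rmorphD !rmorphM !rmorph1 /= !diagJ !mul1r !mulr1 !conjCi.
rewrite rmorphN /= conjCi opprK => /eqP; rewrite -subr_eq0 => /eqP e0.
have eIm : (X j i)^* - (X i j)^* = X i j - X j i.
  apply/(mulfI (neq0Ci R[i]))/eqP; rewrite -subr_eq0 -[X in _ == X]e0; apply/eqP; ring.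
have /eqP : (X j i)^* *+ 2 = X i j *+ 2.
  have -> : (X j i)^* *+ 2 = ((X i j)^* + (X j i)^*) + ((X j i)^* - (X i j)^*) by ring.
  by rewrite eRe eIm; ring.
by rewrite eqr_pMn2r // => /eqP <-; rewrite conjCK.
Qed.

(* The test vectors X_jj e_i - X_ji e_j and -X_ij e_i + X_ii e_j suffice unless
   both diagonal entries vanish. *)
Lemma psd_minor X i j : psd X -> X i j * X j i <= X i i * X j j.
Proof.
move=> Xpsd; have XJ := psd_hermitian X i j Xpsd.
have [Xii Xjj] := (psd_diag_ge0 X i Xpsd, psd_diag_ge0 X j Xpsd).
have XiiJ := conj_Creal (ger0_real Xii); have XjjJ := conj_Creal (ger0_real Xjj).
have [Xj0|Xj_neq0] := eqVneq (X j j) 0; last first.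
  rewrite -subr_ge0 -(pmulr_rge0 _ (_ : 0 < X j j)) ?lt_def ?Xj_neq0 //.
  have := psd_form X i j (X j j) (- X j i) Xpsd.
  by rewrite rmorphN /= XjjJ XJ conjCK; congr (0 <= _); ring.
have [Xi0|Xi_neq0] := eqVneq (X i i) 0; last first.
  rewrite -subr_ge0 -(pmulr_rge0 _ (_ : 0 < X i i)) ?lt_def ?Xi_neq0 //.
  have := psd_form X i j (- X i j) (X i i) Xpsd.
  by rewrite rmorphN /= XiiJ XJ; congr (0 <= _); ring.
(* With both diagonal entries zero, this vector leaves [-2 |X_ij|^2 >= 0]. *)
have := psd_form X i j 1 (- X j i) Xpsd.
rewrite rmorphN rmorph1 /= Xi0 Xj0 XJ conjCK !(mulr0, mul1r, mulr1, add0r, addr0).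
by rewrite !mulNr [_^* * _]mulrC -opprD oppr_ge0 -mulr2n pmulrn_lle0.
Qed.

(** Summing the inequality for 2 x 2 minors over all pairs of indices. *)
Lemma psd_trace_sqr X : psd X -> \tr (X *m X) <= (\tr X) ^+ 2.
Proof.
move=> Xpsd; rewrite expr2 /mxtrace big_distrlr /=.
apply: ler_sum => i _; rewrite mxE; apply: ler_sum => j _; exact: psd_minor.
Qed.

Lemma psd_trace_ge0 X : psd X -> 0 <= \tr X.
Proof. by move=> Xpsd; apply: sumr_ge0 => i _; apply: psd_diag_ge0. Qed.

(** For Hermitian [X] the trace is the sum of all [|X_ij|^2]. *)
Lemma hermitian_trace_sqr_ge0 X :
  (forall i j, X j i = (X i j)^*) -> 0 <= \tr (X *m X).
Proof.
move=> XJ; apply: sumr_ge0 => i _; rewrite mxE; apply: sumr_ge0 => j _.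
by rewrite (XJ i j) mul_conjC_ge0.
Qed.

Lemma projector_hermitian v i j : projector v j i = (projector v i j)^*.
Proof. by rewrite !mxE !big_ord1 !mxE rmorphM /= conjCK mulrC. Qed.

Lemma trace_mul_projector X v : \tr (X *m projector v) = (v^t* *m X *m v) 0 0.
Proof. by rewrite mulmxA mxtrace_mulC mulmxA trace_mx11. Qed.

Lemma psd_projector v : psd (projector v).
Proof.
move=> w; rewrite /projector !mulmxA -mulmxA !mxE big_ord1.
set a := (w^t* *m v) 0 0.
have -> : (v^t* *m w) 0 0 = a^*.
  rewrite /a !mxE rmorph_sum; apply: eq_bigr => k _.
  by rewrite !mxE rmorphM /= conjCK mulrC.
exact: mul_conjC_ge0.
Qed.

End Psd.

(** * The discrete Fourier transform and the bound by [lambda_max] *)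

Section Fourier.
Local Open Scope ring_scope.
Context (R : realType) (d : nat).
Local Notation w := (omega R d).
Implicit Types (f g q : 'I_d -> R).

Lemma omegaX n : w ^+ n = cos (n%:R * (2 * pi / d%:R)) +i* sin (n%:R * (2 * pi / d%:R)).
Proof.
elim: n => [|n IHn]; first by rewrite expr0 mul0r cos0 sin0.
set t : R := 2 * pi / d%:R in IHn *.
rewrite exprSr IHn (_ : n.+1%:R * t = n%:R * t + t) ?cosD ?sinD; last by rewrite -natr1 mulrDl mul1r.
by apply/eqP; rewrite eq_complex /= addrC [X in _ && (X == _)]addrC !eqxx.
Qed.

Lemma omega_normr : `|w| = 1.
Proof. by rewrite normc_def /= cos2Dsin2 sqrtr1. Qed.

Lemma omega_neq0 : w != 0.
Proof. by rewrite -normr_eq0 omega_normr oner_eq0. Qed.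

Lemma omega_conj : w^* = w^-1.
Proof.
apply: (mulfI omega_neq0).
by rewrite -normCK omega_normr expr1n divff // omega_neq0.
Qed.

(** Half-angle formula: [cos x = 1 - 2 sin(x/2)^2], with [x/2] strictly between 0 and [pi]. *)
Lemma cos_lt1 (x : R) : 0 < x -> x < pi *+ 2 -> cos x < 1.
Proof.
move=> x_gt0 x_lt2pi; have sin_gt0 : 0 < sin (x / 2).
  by apply: sin_gt0_pi; apply/andP; split; lra.
have -> : x = (x / 2) *+ 2 by field.
rewrite cos_mulr2n.
have : 0 < sin (x / 2) ^+ 2 by rewrite exprn_gt0.
have := cos2Dsin2 (x / 2).
lra.
Qed.

(** A power with exponent strictly between 0 and [d] has real part below 1 by [cos_lt1], hence
    differs from 1. *)
Lemma omega_prim : (0 < d)%N -> d.-primitive_root w.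
Proof.
move=> d_gt0; have dR_gt0 : 0 < d%:R :> R by rewrite ltr0n.
rewrite /primitive_root_of_unity d_gt0; apply/forallP => i.
rewrite unity_rootE omegaX; apply/eqP.
have [id|id] := eqVneq i.+1 d.
  have -> : i.+1%:R * (2 * pi / d%:R) = pi *+ 2 :> R.
    by rewrite id; field; rewrite gt_eqF.
  by rewrite cos2pi sin2pi eqxx.
have i_ltd : (i.+1 < d)%N by rewrite ltn_neqAle id ltn_ord.
apply: contraNF (id) => /eqP /(congr1 (@complex.Re R)) /= cos1.
have := @cos_lt1 (i.+1%:R * (2 * pi / d%:R)).
rewrite cos1 ltxx => H; have : false; last by [].
apply: H; first by rewrite !mulr_gt0 ?invr_gt0 ?pi_gt0 // ltr0n.
rewrite mulrA ltr_pdivrMr // -[pi *+ 2]mulr_natl [ltRHS]mulrC ltr_pM2r ?ltr_nat //.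
by rewrite mulr_gt0 ?pi_gt0.
Qed.

Lemma omega_orthogonality (a b : nat) : (0 < d)%N ->
  \sum_(j < d) w ^- (j * a) * w ^+ (j * b) = (a == b %[mod d])%:R * d%:R.
Proof.
move=> d_gt0; have w_prim := omega_prim d_gt0.
(* The sum is geometric with ratio [z], and [z ^+ d = 1]: it equals [d] if [z = 1] and 0
   otherwise. *)
pose z := w ^- a * w ^+ b.
have -> : \sum_(j < d) w ^- (j * a) * w ^+ (j * b) = \sum_(j < d) z ^+ j.
  by apply: eq_bigr => j _; rewrite exprMn exprVn -!exprM ![(_ * j)%N]mulnC.
have -> : (a == b %[mod d]) = (z == 1).
  rewrite -(eq_prim_root_expr w_prim) /z.
  have wa_neq0 : w ^+ a != 0 by rewrite expf_neq0 // omega_neq0.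
  by rewrite -[RHS](inj_eq (mulfI wa_neq0)) mulVKf // mulr1 eq_sym.
have zd : z ^+ d = 1.
  by rewrite exprMn exprVn -!exprM ![(_ * d)%N]mulnC !exprM (prim_expr_order w_prim) !expr1n invr1 mulr1.
have [->|z_neq1] := eqVneq z 1.
  by under eq_bigr do rewrite expr1n; rewrite sumr_const card_ord mul1r.
rewrite mul0r; apply/(mulfI (_ : z - 1 != 0)); first by rewrite subr_eq0.
by rewrite -subrX1 zd subrr mulr0.
Qed.

(* N_{j, d - j} in the paper's indexing, for f = q. *)
Definition dft f (j : nat) : R[i] := \sum_(m < d) w ^- (j * m) * (f m)%:C.

Lemma dft_conj f j : (dft f j)^* = \sum_(m < d) w ^+ (j * m) * (f m)%:C.
Proof.
rewrite rmorph_sum; apply: eq_bigr => m _.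
rewrite rmorphM /= [(_%:C)^*]conj_Creal ?complex_real //.
by rewrite fmorphV rmorphXn /= omega_conj exprVn invrK.
Qed.

(** The exponent is any representative [n] of [k], so that [k + l] can later stand unreduced for
    [add_mod k l]. *)
Lemma dft_inversion f (k : 'I_d) (n : nat) : k = n %[mod d] ->
  \sum_(j < d) dft f j * w ^+ (j * n) = d%:R * (f k)%:C.
Proof.
move=> kn; have d_gt0 : (0 < d)%N by apply: leq_ltn_trans (ltn_ord k).
under eq_bigr do rewrite mulr_suml.
rewrite exchange_big /= (bigD1 k) //= [X in _ + X]big1 => [|m m_neq]; last first.
  under eq_bigr do rewrite mulrAC.
  rewrite -mulr_suml omega_orthogonality // -kn !modn_small //.
  by rewrite (inj_eq val_inj) (negPf m_neq) !mul0r.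
under eq_bigr do rewrite mulrAC.
by rewrite -mulr_suml omega_orthogonality // kn eqxx mul1r addr0.
Qed.

Lemma dft_parseval f :
  \sum_(j < d) `|dft f j| ^+ 2 = d%:R * (\sum_k f k ^+ 2)%:C.
Proof.
under eq_bigr do rewrite normCK dft_conj mulr_sumr.
rewrite exchange_big rmorph_sum mulr_sumr; apply: eq_bigr => k _ /=.
under eq_bigr do rewrite mulrA.
by rewrite -mulr_suml (dft_inversion f k) // -mulrA expr2 rmorphM.
Qed.

(** Inversion expands [q (add_mod k l)] in powers of [w], and [w ^+ (j * (k + l))] factors into a
    part in [k] and a part in [l]. The sum of the indices is what puts conjugates on both [f] and
    [g]. *)
Lemma dft_convolution q f g :
  d%:R * (\sum_k \sum_l f k * g l * q (add_mod k l))%:C =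
  \sum_(j < d) dft q j * ((dft f j)^* * (dft g j)^*).
Proof.
under [RHS]eq_bigr do rewrite !dft_conj big_distrlr /= mulr_sumr.
rewrite [RHS]exchange_big rmorph_sum mulr_sumr; apply: eq_bigr => k _ /=.
under [RHS]eq_bigr do rewrite mulr_sumr.
rewrite [RHS]exchange_big rmorph_sum mulr_sumr; apply: eq_bigr => l _ /=.
transitivity (\sum_(j < d) dft q j * w ^+ (j * (k + l)) * ((f k)%:C * (g l)%:C)).
  rewrite -mulr_suml (dft_inversion q (add_mod k l)) ?modn_mod //.
  rewrite !rmorphM /=. ring.
by apply: eq_bigr => j _; rewrite mulnDr exprD; ring.
Qed.

Lemma le_normc (z : R[i]) (r : R) : (`|z| <= r%:C) = (ComplexField.Normc.normc z <= r).
Proof. by rewrite -lecR. Qed.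

Lemma normc_real (x : R) : `|x%:C| = `|x|%:C.
Proof. by rewrite normc_def /= expr0n addr0 sqrtr_sqr. Qed.

Lemma dft0 f : dft f 0 = (\sum_k f k)%:C.
Proof.
rewrite rmorph_sum; apply: eq_bigr => k _.
by rewrite mul0n expr0 invr1 mul1r.
Qed.

Lemma dft_rev f (j : nat) : (0 < j < d)%N -> dft f (d - j) = (dft f j)^*.
Proof.
move=> /andP[j_gt0 j_ltd]; have d_gt0 := ltn_trans j_gt0 j_ltd.
rewrite dft_conj; apply: eq_bigr => m _; congr (_ * _).
have wjm_neq0 : w ^+ ((d - j) * m) != 0 by rewrite expf_neq0 // omega_neq0.
apply: (mulfI wjm_neq0); rewrite divff // -exprD -mulnDl subnK ?(ltnW j_ltd) //.
by rewrite exprM (prim_expr_order (omega_prim d_gt0)) expr1n.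
Qed.

(** The maximum runs over the lower half of the frequencies only; by [dft_rev] the frequencies [j]
    and [d - j] have equal modulus. *)
Lemma dft_le_lambda_max q (j : nat) : (0 < j < d)%N ->
  `|dft q j| <= (lambda_max (Nmx q))%:C.
Proof.
pose half := (if odd d then d.-1./2 else d./2)%N.
wlog j_half : j / (j <= half)%N => [wlog_half j_bnd|].
  have [/wlog_half->//|half_lt] := leqP j half.
  rewrite -norm_conjC -dft_rev //; apply: wlog_half; last by lia.
  by rewrite /half in half_lt *; case: ifP half_lt => ?; lia.
move=> /andP[j_gt0 j_ltd].
have i_ltd : (j.-1 < d.-1)%N by lia.
have -> : dft q j = Nmx q (Ordinal i_ltd) (rev_ord (Ordinal i_ltd)).
  rewrite mxE /= (_ : _ == d = true) ?prednK //; lia.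
rewrite le_normc /lambda_max.
by rewrite (le_bigmax_cond _ (fun i => _ (Nmx q i (rev_ord i)))) //= prednK.
Qed.

(** On the Fourier side the form is diagonal. Frequency 0 vanishes because [f] sums to 0; at the
    others the factor from [q] is at most [lam]. The arithmetic-geometric mean inequality and
    Parseval then return to sums of squares. *)
Lemma dft_bilinear_bound (lam : R) q f g : (0 < d)%N -> 0 <= lam ->
  (forall j, (0 < j < d)%N -> `|dft q j| <= lam%:C) ->
  \sum_k f k = 0 ->
  \sum_k \sum_l f k * g l * q (add_mod k l) <=
    lam * ((\sum_k f k ^+ 2 + \sum_k g k ^+ 2) / 2).
Proof.
move=> d_gt0 lam_ge0 qlam f0; apply: le_trans (ler_norm _) _.
set B := \sum_k _; rewrite -lecR -normc_real.
have d_gt0' : 0 < d%:R :> R[i] by rewrite ltr0n.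
rewrite -(ler_pM2l d_gt0') -[in leLHS](ger0_norm (ltW d_gt0')) -normrM dft_convolution.
apply: le_trans (ler_norm_sum _ _ _) _.
have -> : d%:R * (lam * ((\sum_k f k ^+ 2 + \sum_k g k ^+ 2) / 2))%:C =
    \sum_(j < d) lam%:C * ((`|dft f j| ^+ 2 + `|dft g j| ^+ 2) / 2).
  rewrite -mulr_sumr -mulr_suml big_split /= !dft_parseval !(rmorphM, rmorphD, fmorphV, rmorph_nat) /=.
  by ring.
apply: ler_sum => j _; rewrite !normrM !norm_conjC.
have [j0|j_gt0] := posnP j.
  rewrite [X in dft f X]j0 dft0 f0 normr0 mul0r mulr0; apply: mulr_ge0; first by rewrite ler0c.
  by rewrite divr_ge0 ?addr_ge0 ?exprn_ge0.
apply: ler_pM; rewrite ?mulr_ge0 ?qlam ?j_gt0 ?ltn_ord //.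
rewrite ler_pdivlMr ?ltr0n // -subr_ge0.
rewrite (_ : _ - _ = (`|dft f j| - `|dft g j|) ^+ 2); last by ring.
by rewrite -realEsqr rpredB ?normr_real.
Qed.
End Fourier.

(** * Orthonormal bases, rotations about the axis and traces *)

Section Bases.
Local Open Scope ring_scope.
Local Open Scope sesquilinear_scope.
Context (R : realType) (d : nat).
Implicit Types (X : 'M[R[i]]_d) (e : 'I_d -> 'cV[R[i]]_d).

(** Orthonormality says [E^t* *m E = 1]; for a square matrix this gives [E *m E^t* = 1], which is
    the completeness relation. *)
Lemma sum_projector e : orthonormal_basis e -> \sum_k projector (e k) = 1%:M.
Proof.
move=> e_on; pose E := \matrix_(i, k) e k i 0.
have /mulmx1C EE : E^t* *m E = 1%:M.
  apply/matrixP => k l; rewrite [RHS]mxE -e_on !mxE.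
  by apply: eq_bigr => j _; rewrite !mxE.
rewrite -EE; apply/matrixP => j k; rewrite summxE mxE.
by apply: eq_bigr => l _; rewrite !mxE big_ord1 !mxE.
Qed.

Lemma projector_overlap e k l : orthonormal_basis e ->
  \tr (projector (e k) *m projector (e l)) = (k == l)%:R.
Proof.
move=> e_on; rewrite trace_mul_projector /projector !mulmxA -mulmxA mxE big_ord1.
by rewrite !e_on eq_sym -natrM mulnb andbb.
Qed.

Lemma trace_projector e k : orthonormal_basis e -> \tr (projector (e k)) = 1.
Proof. by move=> e_on; rewrite mxtrace_mulC trace_mx11 e_on eqxx. Qed.

Lemma sum_trace_projector e X : orthonormal_basis e ->
  \sum_k \tr (X *m projector (e k)) = \tr X.
Proof. by move=> e_on; rewrite -raddf_sum -mulmx_sumr sum_projector // mulmx1. Qed.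

Lemma rotation_row_sum (O : 'M[R]_d) k : rotation_about_nstar O -> \sum_l O k l = 1.
Proof.
move=> [_ /matrixP/(_ k 0)]; rewrite !mxE.
under eq_bigr do rewrite mxE.
rewrite -mulr_suml -[RHS]mul1r; apply: mulIf.
by rewrite invr_eq0 sqrtr_eq0 -ltNge ltr0n (leq_ltn_trans (leq0n k)).
Qed.

(** The transpose is again a rotation about the same axis, so its row sums apply. *)
Lemma rotation_col_sum (O : 'M[R]_d) l : rotation_about_nstar O -> \sum_k O k l = 1.
Proof.
move=> [OO On]; rewrite -[RHS](@rotation_row_sum O^T l).
  by apply: eq_bigr => k _; rewrite mxE.
by split; [rewrite trmxK; apply: mulmx1C | rewrite -{1}On mulmxA OO mul1mx].
Qed.

Lemma rotation_norm (O : 'M[R]_d) (f : 'I_d -> R) : rotation_about_nstar O ->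
  \sum_k (\sum_l O k l * f l) ^+ 2 = \sum_l f l ^+ 2.
Proof.
move=> [OO _]; pose u : 'cV[R]_d := \col_l f l.
have -> : \sum_l f l ^+ 2 = (u^T *m u) 0 0.
  by rewrite mxE; apply: eq_bigr => l _; rewrite !mxE.
have -> : \sum_k (\sum_l O k l * f l) ^+ 2 = ((O *m u)^T *m (O *m u)) 0 0.
  rewrite [RHS]mxE; apply: eq_bigr => k _.
  by rewrite !mxE expr2; congr (_ * _); apply: eq_bigr => l _; rewrite !mxE.
by rewrite trmx_mul mulmxA -[_ *m _ *m O]mulmxA OO mulmx1.
Qed.

Lemma trace_sqr_sub X (D : 'M[R[i]]_d) (x : R[i]) :
  \tr ((X - x *: D) *m (X - x *: D)) =
    \tr (X *m X) - 2 * x * \tr (X *m D) + x ^+ 2 * \tr (D *m D).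
Proof.
rewrite mulmxBl !mulmxBr -!scalemxAl -!scalemxAr !raddfB /= !mxtraceZ.
rewrite [\tr (D *m X)]mxtrace_mulC; ring.
Qed.
End Bases.

(** * Real inequalities *)

Section RealEstimates.
Local Open Scope ring_scope.
Context (R : realType).

Lemma sum_cauchy_schwarz (I : finType) (u v : I -> R) :
  (\sum_i u i * v i) ^+ 2 <= (\sum_i u i ^+ 2) * (\sum_i v i ^+ 2).
Proof.
rewrite -subr_ge0 -(pmulr_rge0 _ (ltr0n R 2)).
(* Lagrange's identity; the double sum counts each unordered pair twice, whence the factor 2. *)
have -> : 2 * ((\sum_i u i ^+ 2) * (\sum_i v i ^+ 2) - (\sum_i u i * v i) ^+ 2) =
    \sum_i \sum_j (u i * v j - u j * v i) ^+ 2.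
  transitivity ((\sum_i u i ^+ 2) * (\sum_i v i ^+ 2)
      + (\sum_i v i ^+ 2) * (\sum_i u i ^+ 2)
      - 2 * ((\sum_i u i * v i) * (\sum_i u i * v i))); first by ring.
  rewrite !big_distrlr /= mulr_sumr -big_split -sumrB; apply: eq_bigr => i _ /=.
  by rewrite mulr_sumr -big_split -sumrB; apply: eq_bigr => j _ /=; ring.
by apply: sumr_ge0 => i _; apply: sumr_ge0 => j _; apply: sqr_ge0.
Qed.

Lemma sum_pairs_le (L : nat) (W : 'I_L -> 'I_L -> R) (u z : 'I_L -> R) :
  (forall a, W a a = u a) -> (forall a b, a != b -> W a b <= z a + z b) ->
  \sum_a \sum_b W a b <= \sum_a u a + 2 * (L%:R - 1) * \sum_a z a.
Proof.
move=> Wdiag Woff.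
(* The right-hand side is split by rows; the [2 * z a] taken away is the diagonal term [b = a]. *)
have -> : \sum_a u a + 2 * (L%:R - 1) * \sum_a z a =
    \sum_a (u a + (\sum_b (z a + z b) - 2 * z a)).
  rewrite big_split /= sumrB -mulr_sumr; congr (_ + _).
  under [X in _ = X - _]eq_bigr do rewrite big_split /= sumr_const card_ord.
  rewrite big_split /= sumr_const card_ord !sumrMnl -[_ *+ L]mulr_natr; ring.
apply: ler_sum => a _; rewrite (bigD1 a) //= Wdiag lerD2l.
rewrite [leRHS](_ : _ = \sum_(b | b != a) (z a + z b)).
  by apply: ler_sum => b; rewrite eq_sym; apply: Woff.
by rewrite [in LHS](bigD1 a) //=; ring.
Qed.

(** At [x = 1/f], [V <= f S] gives [S <= c f t^2]. Then [V <= (c f + M) t^2], that is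
    [g^2 V <= c t^2], and [x = g] yields [2 g S <= 2 c t^2]. *)
Lemma quadratic_form_bound (c t f M g S V : R) : 0 < g -> 0 < f ->
  (forall x, 0 <= c * t ^+ 2 - 2 * x * S + x ^+ 2 * V) ->
  V <= f * S -> V <= S + M * t ^+ 2 -> g ^+ 2 * (c * f + M) = c ->
  g * S <= c * t ^+ 2.
Proof.
move=> g_gt0 f_gt0 quad VfS VM gE.
have S_le : S <= f * (c * t ^+ 2).
  rewrite -ler_pdivrMl //.
  have := quad f^-1.
  have : f^-1 ^+ 2 * V <= f^-1 * S.
    by rewrite expr2 -mulrA ler_pM2l ?invr_gt0 // ler_pdivrMl.
  lra.
have := quad g.
have : g ^+ 2 * V <= c * t ^+ 2.
  rewrite -[in leRHS]gE -mulrA ler_pM2l ?exprn_gt0 //.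
  by apply: (le_trans VM); rewrite mulrDl lerD2r; lra.
lra.
Qed.
End RealEstimates.

(** * The constant [gamma] *)

Section Gamma.
Local Open Scope ring_scope.
Context (R : realType) (d L : nat) (q : 'I_d -> R).
Context (d_ge2 : (2 <= d)%N) (L_ge2 : (2 <= L)%N) (q_distr : is_distr q).

Lemma le_qmax k : q k <= qmax q.
Proof. exact: le_bigmax. Qed.

Lemma qmax_ge : 1 <= d%:R * qmax q.
Proof.
rewrite -[leLHS](proj2 q_distr) mulr_natl -[X in _ *+ X]card_ord -sumr_const.
by apply: ler_sum => k _; apply: le_qmax.
Qed.

Lemma lambda_max_ge0 : 0 <= lambda_max (Nmx q).
Proof. exact: bigmax_ge_id. Qed.

Lemma fL_ge1 : 1 <= fL L q.
Proof.
by rewrite /fL lerDl mulr_ge0 ?lambda_max_ge0 // subr_ge0 ler1n (leq_trans _ L_ge2).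
Qed.

Lemma gamma_den_gt0 : 0 < (d%:R - 1) * fL L q + L%:R * (L%:R - 1) * (d%:R * qmax q - 1).
Proof.
have d1 : 0 < d%:R - 1 :> R by rewrite subr_gt0 ltr1n.
have L1 : 0 < L%:R - 1 :> R by rewrite subr_gt0 ltr1n.
apply: ltr_wpDr; first by rewrite mulr_ge0 ?(subr_ge0, qmax_ge) ?mulr_ge0 ?(ltW L1).
by rewrite mulr_gt0 // (lt_le_trans _ fL_ge1).
Qed.

Lemma gamma_gt0 : 0 < gamma L q.
Proof. by rewrite sqrtr_gt0 divr_gt0 ?gamma_den_gt0 // subr_gt0 ltr1n. Qed.

(** The definition of [gamma] with numerator and denominator divided by [d], in the shape
    [g^2 (c f + M) = c] that [quadratic_form_bound] expects. *)
Lemma gamma_sqr :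
  gamma L q ^+ 2 * ((1 - d%:R^-1) * fL L q + L%:R * (L%:R - 1) * (qmax q - d%:R^-1))
  = 1 - d%:R^-1.
Proof.
have d_neq0 : d%:R != 0 :> R by rewrite pnatr_eq0 -lt0n (leq_trans _ d_ge2).
rewrite sqr_sqrtr; last by rewrite divr_ge0 ?(ltW gamma_den_gt0) // subr_ge0 ler1n (leq_trans _ d_ge2).
by field; rewrite d_neq0 gt_eqF ?gamma_den_gt0.
Qed.
End Gamma.

(** * Deviations of outcome probabilities for equibiased bases *)

Section Equibiased.
Local Open Scope ring_scope.
Context (R : realType) (d L : nat) (q : 'I_d -> R) (e : 'I_L -> 'I_d -> 'cV[R[i]]_d).
Context (d_ge2 : (2 <= d)%N) (L_ge2 : (2 <= L)%N).
Context (q_distr : is_distr q) (e_meb : mutually_equibiased q e).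
Implicit Types (X : 'M[R[i]]_d) (a b : 'I_L) (k l : 'I_d).

(** Taking real parts keeps the estimates in [R]. Nothing is lost for a positive matrix or for its
    product with a projector, whose traces are real. *)
Definition retrace X : R := complex.Re (\tr X).

Definition prob X a k : R := retrace (X *m projector (e a k)).

Definition deviation X a k : R := prob X a k - retrace X / d%:R.

Definition overlap a b k l : R := retrace (projector (e a k) *m projector (e b l)).

Definition total_deviation X : R := \sum_a \sum_k deviation X a k ^+ 2.

Definition deviation_form X a b : R :=
  \sum_k \sum_l deviation X a k * deviation X b l * overlap a b k l.

Let d_neq0 : d%:R != 0 :> R.
Proof. by rewrite pnatr_eq0 -lt0n (leq_trans _ d_ge2). Qed.

Let e_basis a : orthonormal_basis (e a).
Proof. by case: e_meb. Qed.

Lemma retraceE X : psd X -> \tr X = (retrace X)%:C.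
Proof. by move/psd_trace_ge0/ger0_real/RRe_real. Qed.

Lemma probE X a k : psd X -> \tr (X *m projector (e a k)) = (prob X a k)%:C.
Proof.
move=> Xpsd; rewrite [RHS]RRe_real // trace_mul_projector.
exact/ger0_real/Xpsd.
Qed.

Lemma prob_ge0 X a k : psd X -> 0 <= prob X a k.
Proof. by move=> Xpsd; rewrite -ler0c -probE // trace_mul_projector. Qed.

Lemma retrace_ge0 X : psd X -> 0 <= retrace X.
Proof. by move=> Xpsd; rewrite -ler0c -retraceE // psd_trace_ge0. Qed.

Lemma sum_prob X a : psd X -> \sum_k prob X a k = retrace X.
Proof.
move=> Xpsd; apply: (@complexI R); rewrite -retraceE // rmorph_sum /=.
rewrite -(sum_trace_projector _ _ (e a)) //.
by apply: eq_bigr => k _; rewrite probE.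
Qed.

Lemma sum_deviation X a : psd X -> \sum_k deviation X a k = 0.
Proof.
move=> Xpsd; rewrite sumrB sum_prob // sumr_const card_ord -[X in _ - X]mulr_natr.
by rewrite divfK // subrr.
Qed.

(** An overlap is by definition an outcome probability of the positive matrix
    [projector (e a k)]. *)
Lemma overlapE a b k l :
  \tr (projector (e a k) *m projector (e b l)) = (overlap a b k l)%:C.
Proof. exact/probE/psd_projector. Qed.

Lemma overlap_diag a k l : overlap a a k l = (k == l)%:R.
Proof.
by apply: (@complexI R); rewrite -overlapE projector_overlap // rmorph_nat.
Qed.

Lemma sum_overlapr a b k : \sum_l overlap a b k l = 1.
Proof.
apply: (@complexI R); rewrite rmorph_sum rmorph1 /= -[RHS](trace_projector _ _ (e a) k) //.
rewrite -(sum_trace_projector _ _ (e b)) //.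
by apply: eq_bigr => l _; rewrite overlapE.
Qed.

Lemma overlapC a b k l : overlap a b k l = overlap b a l k.
Proof. by rewrite /overlap /retrace mxtrace_mulC. Qed.

Lemma overlap_offdiag a b : a != b ->
  exists s : {perm 'I_d}, forall k l, overlap a b k l = q (add_mod (s k) (s l)).
Proof.
move=> ab; have [_ _ /(_ a b ab)[s [_ sE]]] := e_meb.
by exists s => k l; apply: (@complexI R); rewrite -overlapE.
Qed.

Lemma deviation_form_diag X a : deviation_form X a a = \sum_k deviation X a k ^+ 2.
Proof.
apply: eq_bigr => k _; rewrite (bigD1 k) //= overlap_diag eqxx mulr1 big1 ?addr0 //.
by move=> l lk; rewrite overlap_diag eq_sym (negPf lk) mulr0.
Qed.

(** Relabelling both bases by the inverse of the pair's permutation turns the overlaps into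
    [q (add_mod k l)] and preserves the sums of squares, so the Fourier bound applies. *)
Lemma deviation_form_dft X a b : psd X -> a != b ->
  deviation_form X a b <= lambda_max (Nmx q) *
    ((\sum_k deviation X a k ^+ 2 + \sum_k deviation X b k ^+ 2) / 2).
Proof.
move=> Xpsd /overlap_offdiag[s sE].
have reindexS (F : 'I_d -> R) : \sum_k F k = \sum_k F (s^-1 k)%g.
  by rewrite (reindex_inj (@perm_inj _ s^-1%g)).
rewrite /deviation_form reindexS; under eq_bigr do rewrite reindexS.
under eq_bigr => k _ do under eq_bigr => l _ do rewrite sE !permKV.
rewrite [X in _ * ((X + _) / 2)]reindexS [X in _ * ((_ + X) / 2)]reindexS.
apply: (dft_bilinear_bound _ _ _ q (fun k => deviation X a (s^-1 k)%g)
  (fun k => deviation X b (s^-1 k)%g)).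
- exact: leq_trans d_ge2.
- exact: lambda_max_ge0.
- by move=> j; apply: dft_le_lambda_max.
- by rewrite -(reindexS (deviation X a)) sum_deviation.
Qed.

Lemma sum_overlapl a b l : \sum_k overlap a b k l = 1.
Proof. by under eq_bigr do rewrite overlapC; rewrite sum_overlapr. Qed.

(** The overlaps are doubly stochastic, so centring the probabilities costs exactly [t^2/d]; the
    uncentred form is at most [qmax q * t^2]. *)
Lemma deviation_form_qmax X a b : psd X -> a != b ->
  deviation_form X a b <= (qmax q - d%:R^-1) * retrace X ^+ 2.
Proof.
move=> Xpsd /overlap_offdiag[s sE].
set t := retrace X.
have sum_devr : \sum_k \sum_l deviation X b l * overlap a b k l = 0.
  rewrite exchange_big -[RHS](sum_deviation X b Xpsd) /=.
  by apply: eq_bigr => l _; rewrite -mulr_sumr sum_overlapl mulr1.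
have sum_probl : \sum_k \sum_l prob X a k * overlap a b k l = t.
  rewrite -[RHS](sum_prob X a Xpsd).
  by apply: eq_bigr => k _; rewrite -mulr_sumr sum_overlapr mulr1.
have -> : deviation_form X a b = \sum_k \sum_l prob X a k * prob X b l * overlap a b k l
    - t / d%:R * \sum_k \sum_l prob X a k * overlap a b k l
    - t / d%:R * \sum_k \sum_l deviation X b l * overlap a b k l.
  rewrite !mulr_sumr -!sumrB; apply: eq_bigr => k _.
  rewrite !mulr_sumr -!sumrB; apply: eq_bigr => l _ /=.
  by rewrite /deviation -/t; ring.
have : \sum_k \sum_l prob X a k * prob X b l * overlap a b k l <= t ^+ 2 * qmax q.
  rewrite /t expr2 -{1}(sum_prob X a Xpsd) -(sum_prob X b Xpsd) big_distrlr mulr_suml /=.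
  apply: ler_sum => k _; rewrite mulr_suml; apply: ler_sum => l _.
  by rewrite ler_wpM2l ?mulr_ge0 ?prob_ge0 // sE le_qmax.
rewrite sum_devr sum_probl; lra.
Qed.

(* This is Tr D^2. *)
Definition total_form X : R := \sum_a \sum_b deviation_form X a b.

(** Diagonal pairs give [total_deviation X]. The bound on every other pair is shared equally between
    its two bases, and these halves cancel the 2 in [sum_pairs_le]. *)
Lemma total_form_le_fL X : psd X -> total_form X <= fL L q * total_deviation X.
Proof.
move=> Xpsd.
have := sum_pairs_le R L _ _ (fun a => lambda_max (Nmx q) * (\sum_k deviation X a k ^+ 2) / 2)
  (deviation_form_diag X).
move/(_ _)/le_trans; apply.
  by move=> a b ab; apply: le_trans (deviation_form_dft X a b Xpsd ab) _; lra.
by rewrite -mulr_suml -mulr_sumr /fL -/(total_deviation X) le_eqVlt; apply/orP/or_introl/eqP; field.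
Qed.

Lemma total_form_le_qmax X : psd X ->
  total_form X <= total_deviation X + L%:R * (L%:R - 1) * (qmax q - d%:R^-1) * retrace X ^+ 2.
Proof.
move=> Xpsd.
have := sum_pairs_le R L _ _ (fun a => (qmax q - d%:R^-1) * retrace X ^+ 2 / 2)
  (deviation_form_diag X).
move/(_ _)/le_trans; apply.
  by move=> a b ab; apply: le_trans (deviation_form_qmax X a b Xpsd ab) _; lra.
rewrite sumr_const card_ord -[X in _ * X]mulr_natl -/(total_deviation X).
by rewrite le_eqVlt; apply/orP/or_introl/eqP; field.
Qed.

Lemma deviation_quadratic X (x : R) : psd X ->
  0 <= (1 - d%:R^-1) * retrace X ^+ 2 - 2 * x * total_deviation X + x ^+ 2 * total_form X.
Proof.
move=> Xpsd; set t := retrace X.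
pose D := \sum_a \sum_k (deviation X a k)%:C *: projector (e a k).
have trD (Y : 'M[R[i]]_d) : psd Y ->
    \tr (Y *m D) = (\sum_a \sum_k deviation X a k * prob Y a k)%:C.
  move=> Ypsd; rewrite mulmx_sumr !raddf_sum; apply: eq_bigr => a _ /=.
  rewrite mulmx_sumr !raddf_sum; apply: eq_bigr => k _ /=.
  by rewrite -scalemxAr mxtraceZ probE // rmorphM.
have tr_XD : \tr (X *m D) = (total_deviation X)%:C.
  rewrite trD //; congr (_%:C); apply: eq_bigr => a _.
  transitivity (\sum_k deviation X a k * prob X a k - t / d%:R * \sum_k deviation X a k).
    by rewrite sum_deviation // mulr0 subr0.
  by rewrite mulr_sumr -sumrB; apply: eq_bigr => k _; rewrite /deviation -/t; ring.
(* Hence subtracting a multiple of the identity from [X] does not change its trace against [D]. *)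
have tr_D : \tr D = 0.
  rewrite !raddf_sum big1 // => a _; rewrite !raddf_sum.
  transitivity ((\sum_k deviation X a k)%:C); last by rewrite sum_deviation.
  rewrite rmorph_sum; apply: eq_bigr => k _ /=.
  by rewrite mxtraceZ trace_projector // mulr1.
have tr_DD : \tr (D *m D) = (total_form X)%:C.
  rewrite mulmx_suml !raddf_sum; apply: eq_bigr => a _ /=.
  under [in RHS]eq_bigr do rewrite /deviation_form.
  rewrite [in RHS]exchange_big mulmx_suml !raddf_sum; apply: eq_bigr => k _ /=.
  rewrite -scalemxAl mxtraceZ trD; last exact: psd_projector.
  rewrite -rmorphM mulr_sumr; congr (_%:C); apply: eq_bigr => b _.
  rewrite mulr_sumr; apply: eq_bigr => l _.
  by rewrite mulrA; congr (_ * _).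
pose X0 := X - (t / d%:R)%:C *: 1%:M.
have D_herm i j : D j i = (D i j)^*.
  rewrite !summxE rmorph_sum; apply: eq_bigr => a _ /=.
  rewrite !summxE rmorph_sum; apply: eq_bigr => k _ /=.
  by rewrite [in LHS]mxE [in RHS]mxE rmorphM /= -projector_hermitian [(_%:C)^*]conj_Creal // complex_real.
have : 0 <= \tr ((X0 - x%:C *: D) *m (X0 - x%:C *: D)).
  apply: hermitian_trace_sqr_ge0 => i j.
  rewrite !mxE !rmorphD !rmorphN !rmorphM /= -D_herm -psd_hermitian //.
  by rewrite ![(_%:C)^*]conj_Creal ?complex_real // rmorph_nat eq_sym.
rewrite trace_sqr_sub /X0 trace_sqr_sub.
rewrite mulmxBl raddfB /= -scalemxAl mxtraceZ !mul1mx tr_D mulr0 subr0 tr_XD tr_DD.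
rewrite !mulmx1 mxtrace1 (retraceE X) // -/t => tr_ge0; rewrite -ler0c; apply: le_trans tr_ge0 _.
(* The expanded trace contains [Tr X^2 - t^2/d]; replacing [Tr X^2] by [t^2] only enlarges it. *)
have := psd_trace_sqr _ _ _ Xpsd; rewrite (retraceE X) // -/t -rmorphXn => trXX.
rewrite -subr_ge0.
rewrite (_ : _ - _ = (t ^+ 2)%:C - \tr (X *m X)); first by rewrite subr_ge0.
rewrite !(rmorph_nat, rmorphM, rmorphXn, rmorphB, rmorphD, fmorphV, rmorph1) /=.
by field; rewrite pnatr_eq0 -lt0n (leq_trans _ d_ge2).
Qed.

Lemma gamma_total_deviation X : psd X ->
  gamma L q * total_deviation X <= (1 - d%:R^-1) * retrace X ^+ 2.
Proof.
move=> Xpsd; apply: (@quadratic_form_bound R _ _ (fL L q)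
  (L%:R * (L%:R - 1) * (qmax q - d%:R^-1)) _ _ (total_form X)).
- exact: gamma_gt0.
- by rewrite (lt_le_trans _ (fL_ge1 _ _ _ _ _)).
- by move=> x; apply: deviation_quadratic.
- exact: total_form_le_fL.
- exact: total_form_le_qmax.
- exact: gamma_sqr.
Qed.

(** * The rotated map: trace and positivity *)

Section Rotations.
Context (O : 'I_L -> 'M[R]_d) (O_rot : forall a, rotation_about_nstar (O a)).

(** Cauchy-Schwarz over all pairs [(a, k)]: rotations preserve the sums of squares, and each of the
    two factors is controlled by [gamma_total_deviation]. *)
Lemma gamma_rotated_deviation X Y : psd X -> psd Y ->
  gamma L q * \sum_a \sum_k (\sum_l O a k l * deviation X a l) * deviation Y a k
    <= (1 - d%:R^-1) * (retrace X * retrace Y).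
Proof.
move=> Xpsd Ypsd; set B := \sum_a _.
have c_ge0 : 0 <= 1 - d%:R^-1 :> R.
  by rewrite subr_ge0 invf_le1 ?ler1n ?ltr0n (leq_trans _ d_ge2).
have g_ge0 := ltW (gamma_gt0 R d L q d_ge2 L_ge2 q_distr).
have [tX tY] := (retrace_ge0 X Xpsd, retrace_ge0 Y Ypsd).
apply: le_trans (ler_norm _) _.
rewrite -(@ler_pXn2r _ 2) ?nnegrE ?mulr_ge0 // real_normK ?num_real //.
have BB : B ^+ 2 <= total_deviation X * total_deviation Y.
  have -> : total_deviation X = \sum_a \sum_k (\sum_l O a k l * deviation X a l) ^+ 2.
    by apply: eq_bigr => a _; rewrite rotation_norm.
  by rewrite /B /total_deviation !pair_bigA; apply: sum_cauchy_schwarz.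
apply: (@le_trans _ _ ((gamma L q * total_deviation X) * (gamma L q * total_deviation Y))).
  by rewrite exprMn [leRHS]mulrACA -expr2 ler_wpM2l ?exprn_ge0.
have S_ge0 Z : 0 <= total_deviation Z.
  by do 2!(apply: sumr_ge0 => ? _); apply: sqr_ge0.
rewrite [leRHS](_ : _ = (1 - d%:R^-1) * retrace X ^+ 2 * ((1 - d%:R^-1) * retrace Y ^+ 2)).
  by apply: ler_pM; rewrite ?gamma_total_deviation // mulr_ge0.
by ring.
Qed.

(** Unit row sums carry the constant part through [O a]; unit column sums keep the rotated
    deviations centred, so the cross terms vanish. *)
Lemma rotated_prob X Y a : psd X -> psd Y ->
  \sum_k \sum_l O a k l * prob X a l * prob Y a k =
  \sum_k (\sum_l O a k l * deviation X a l) * deviation Y a k + retrace X * retrace Y / d%:R.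
Proof.
move=> Xpsd Ypsd.
(* [U] is kept opaque so that unfolding [deviation] leaves it alone. *)
have [U UE] : exists U, U =1 fun k => \sum_l O a k l * deviation X a l by eexists.
have sumU : \sum_k U k = 0.
  under eq_bigr do rewrite UE.
  rewrite exchange_big -[RHS](sum_deviation X a Xpsd); apply: eq_bigr => l _ /=.
  by rewrite -mulr_suml rotation_col_sum // mul1r.
have inner k : \sum_l O a k l * prob X a l = U k + retrace X / d%:R.
  have -> : retrace X / d%:R = \sum_l O a k l * (retrace X / d%:R).
    by rewrite -mulr_suml rotation_row_sum // mul1r.
  rewrite UE -big_split /=.
  by apply: eq_bigr => l _; rewrite /deviation; ring.
under [in RHS]eq_bigr do rewrite -UE.
transitivity (\sum_k U k * deviation Y a k + retrace Y / d%:R * (\sum_k U k)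
   + retrace X / d%:R * \sum_k prob Y a k).
  rewrite !mulr_sumr -!big_split; apply: eq_bigr => k _ /=.
  by rewrite -mulr_suml inner /deviation; ring.
by rewrite sumU sum_prob //; ring.
Qed.

Lemma trace_Phi g X : \tr (Phi g O e X) = \tr X.
Proof.
have tr1 : \tr (\sum_a \sum_k \sum_l
    ((O a k l)%:C * \tr (X *m projector (e a l))) *: projector (e a k)) = L%:R * \tr X.
  rewrite raddf_sum mulr_natl -[X in _ *+ X]card_ord -sumr_const /=.
  apply: eq_bigr => a _; rewrite raddf_sum /=.
  rewrite -(sum_trace_projector _ _ (e a)) //.
  under eq_bigr do rewrite raddf_sum /=.
  rewrite exchange_big; apply: eq_bigr => l _ /=.
  under eq_bigr do rewrite mxtraceZ trace_projector // mulr1.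
  by rewrite -mulr_suml -rmorph_sum rotation_col_sum // mul1r.
rewrite /Phi raddfB /= !mxtraceZ mxtrace1 tr1.
rewrite !(rmorphM, rmorphD, rmorphB, fmorphV, rmorph1, rmorph_nat) /=.
by field; rewrite subr_eq0 pnatr_eq1 pnatr_eq0 gtn_eqF // gtn_eqF // ltnW.
Qed.

(** The constant parts of the [L] bases contribute [-g L / (d (d - 1))], which reduces the
    coefficient of the identity to [1/d]. *)
Lemma trace_Phi_mul g X Y : psd X -> psd Y ->
  \tr (Phi g O e X *m Y) =
   (retrace X * retrace Y / d%:R - g / (d%:R - 1) *
    \sum_a \sum_k (\sum_l O a k l * deviation X a l) * deviation Y a k)%:C.
Proof.
move=> Xpsd Ypsd.
have trS : \tr ((\sum_a \sum_k \sum_l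
    ((O a k l)%:C * \tr (X *m projector (e a l))) *: projector (e a k)) *m Y) =
   (\sum_a \sum_k \sum_l O a k l * prob X a l * prob Y a k)%:C.
  rewrite mulmx_suml !raddf_sum; apply: eq_bigr => a _ /=.
  rewrite mulmx_suml !raddf_sum; apply: eq_bigr => k _ /=.
  rewrite mulmx_suml !raddf_sum; apply: eq_bigr => l _ /=.
  by rewrite -scalemxAl mxtraceZ [\tr (_ *m Y)]mxtrace_mulC !probE // !rmorphM.
rewrite /Phi mulmxBl raddfB /= -!scalemxAl !mxtraceZ trS mul1mx (retraceE X) // (retraceE Y) //.
rewrite -!rmorphM -rmorphB; congr (_%:C).
rewrite (eq_bigr _ (fun a _ => rotated_prob X Y a Xpsd Ypsd)).
rewrite big_split sumr_const card_ord /=.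
rewrite -[_ *+ L]mulr_natl; set B := \sum_a _.
by field; rewrite subr_eq0 pnatr_eq1 pnatr_eq0 gtn_eqF // gtn_eqF // ltnW.
Qed.

Lemma positive_Phi : positive_map (Phi (gamma L q) O e).
Proof.
(* The form at [v] is the trace against the positive matrix [projector v]. *)
move=> X Xpsd v; rewrite -trace_mul_projector.
have vpsd := psd_projector _ _ v.
rewrite trace_Phi_mul // ler0c subr_ge0.
have d1_gt0 : 0 < d%:R - 1 :> R by rewrite subr_gt0 ltr1n.
rewrite mulrAC ler_pdivrMr //.
apply: le_trans (gamma_rotated_deviation X _ Xpsd vpsd) _.
by rewrite le_eqVlt; apply/orP/or_introl/eqP; field.
Qed.


End Rotations.
End Equibiased.

Theorem proposition6 (R : realType) (d L : nat) (q : 'I_d -> R)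
    (e : 'I_L -> 'I_d -> 'cV[R[i]]_d) (O : 'I_L -> 'M[R]_d)
    (hd : (2 <= d)%N) (hL : (2 <= L)%N)
    (hq : is_distr q)
    (he : mutually_equibiased q e)
    (hlambda : lambda_max (Nmx q) < (L%:R - 1)^-1)
    (hO : forall a : 'I_L, rotation_about_nstar (O a)) :
  positive_map (Phi (gamma L q) O e) /\ trace_preserving (Phi (gamma L q) O e).
Proof.
split; first exact: positive_Phi hd hL hq he _ hO.
by move=> X; apply: (trace_Phi R d L q e hd he O hO).
Qed.
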